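(* Let $n\ge2$, let $G=\langle a_1,\dots,a_n\rangle$ be free of rank $n$, and let $L_n$ be the set of endomorphisms of $G$ defined in the context. If the limit defining the asymptotic density $D(L_n)$ exists, then $$D(L_n)\ \ge\ d_n^*=\sum_{c=0}^{n}\sum_{b=0}^{n-c}\binom nc\binom{n-c}{b}2^b\left(\frac{n-1}{n(2n-1)^2}\right)^c K_{c,b}\prod_{j=1}^{b}\frac{2(n-1)^2-(2c+b+j-1)}{n(2n-1)^2},$$ where $$K_{c,b}=\prod_{k=c+b+1}^{n}\frac{4(n-1)^4-(8k-6)(n-1)^2+4k^2-6k+2}{n(n-1)(2n-1)^2}.$$
   Context: Density: let $G_p$ be the set of elements of $G$ of reduced word length at most $p$. An endomorphism $\phi$ is identified with $(\phi(a_1),\dots,\phi(a_n))\in G^n$. For a set $S\subset G^n$, $D(S)=\lim_{p\to\infty}\frac{|S\cap G_p^n|}{|G_p^n|}$, where $G_p^n=(G_p)^n$. Wagner tails: for an endomorphism $\phi$ of $G$, each $i$ and each occurrence of a letter $a_i^{\epsilon}$ ($\epsilon=\pm1$) in the reduced word $\phi(a_i)$, write the reduced product $\phi(a_i)=va_i^{\epsilon}\overline v$; the occurrence gives two Wagner tails: $w=v$, $\overline w=\overline v^{-1}$ if $\epsilon=1$, and $w=va_i^{-1}$, $\overline w=\overline v^{-1}a_i$ if $\epsilon=-1$. $\phi$ is $w$-nontrivial if all these tails are nontrivial. A word is $a_k$-free if neither $a_k$ nor $a_k^{-1}$ appears in it. For a $w$-nontrivial $\phi$, the reduced word $\phi(a_k)$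 is of one of the following types (all products reduced): Type 0: $\phi(a_k)=s_ka_k^{\pm1}m_ka_k^{\pm1}l_k^{-1}$ with $s_k,l_k$ nontrivial and $a_k$-free; Type 1a: $\phi(a_k)=a_k^{-1}m_ka_k^{\pm1}l_k^{-1}$ with $l_k$ nontrivial and $a_k$-free, and then $s_k:=a_k^{-1}$; Type 1b: $\phi(a_k)=s_ka_k^{\pm1}m_ka_k^{-1}$ with $s_k$ nontrivial and $a_k$-free, and then $l_k:=a_k$; Type 2: $\phi(a_k)=a_k^{-1}m_ka_k^{-1}$, and then $s_k:=a_k^{-1}$, $l_k:=a_k$. (The two signs $\pm$ in a product are independent.) For a word $u$, $u|_r$ denotes its initial subword of length $r$ (if $u$ has length less than $r$, then $u|_r$ is undefined and is regarded as different from every word of length $r$). $L_n$ is the set of $w$-nontrivial endomorphisms $\phi$, with every $\phi(a_k)$ of Type 0, Type 1a, Type 1b or Type 2, for which there is an ordering $v_1,\dots,v_{2n}$ of the $2n$ words $\phi(a_1),\phi(a_1)^{-1},\dots,\phi(a_n),\phi(a_n)^{-1}$ such that for all $j<i$: if $v_i=\phi(a_m)$ then $s_m\ne v_j|_{|s_m|}$, and if $v_i=\phi(a_m)^{-1}$ then $l_m\ne v_j|_{|l_m|}$. *)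

(* Defs.v *)
(* MathComp + MathComp-Analysis *)
From HB Require Import structures.
From mathcomp Require Import all_boot all_order all_algebra.
From mathcomp Require Import finmap.
From mathcomp Require Import all_classical all_reals all_analysis.

Set Implicit Arguments.
Unset Strict Implicit.
Unset Printing Implicit Defensive.

Import Order.TTheory GRing.Theory Num.Theory.
Import numFieldNormedType.Exports.

(* The free group on a_1, ..., a_n is modelled by the reduced words over the  *)
(* letters 'I_n * bool, where (i, true) is a_i and (i, false) is a_i^-1.      *)
(* Generators are indexed from 0.                                             *)
Section Words.
Variable n : nat.
Implicit Types (x y : 'I_n * bool) (s t : seq ('I_n * bool)).

Definition linv x : 'I_n * bool := (x.1, ~~ x.2).

Definition reduced s : bool := sorted (fun x y => y != linv x) s.

Definition cons_red x s :=
  if s is y :: s' then if y == linv x then s' else x :: s else [:: x].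

Definition reduce s := foldr cons_red [::] s.

Definition winv s := rev (map linv s).

Lemma linvK : involutive linv.
Proof. by case=> i b; rewrite /linv /= negbK. Qed.

Lemma linv_neq x : linv x != x.
Proof. by case: x => i []; rewrite /linv /= xpair_eqE eqxx. Qed.

Lemma reduced_behead x s : reduced (x :: s) -> reduced s.
Proof. by case: s => //= y s /andP[]. Qed.

Lemma cons_red_reduced x s : reduced s -> reduced (cons_red x s).
Proof.
case: s => //= y s rs; case: ifP => yx; first exact: reduced_behead rs.
by rewrite /reduced /= yx.
Qed.

Lemma foldr_reduced s t : reduced t -> reduced (foldr cons_red t s).
Proof. by move=> rt; elim: s => //= x s /(cons_red_reduced x). Qed.

Lemma reduce_reduced s : reduced (reduce s).
Proof. exact: foldr_reduced. Qed.

Lemma reduce_id s : reduced s -> reduce s = s.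
Proof.
elim: s => //= x s IH rs; rewrite IH; last exact: reduced_behead rs.
by case: s rs {IH} => //= y s /andP[/negPf ->].
Qed.

Lemma cons_redK x s : reduced s -> cons_red x (cons_red (linv x) s) = s.
Proof.
case: s => [|y s] /=; first by rewrite eqxx.
rewrite linvK; case: ifP => [/eqP-> | _] /=; last by rewrite eqxx.
by case: s => //= z s /andP[/negPf ->].
Qed.

Lemma foldr_reduce s t :
  reduced t -> foldr cons_red t (reduce s) = foldr cons_red t s.
Proof.
move=> rt; elim: s => //= x s <-.
case: (reduce s) => //= y r; case: ifP => // /eqP ->.
by rewrite cons_redK // foldr_reduced.
Qed.

Lemma reduce_catl s t : reduce (reduce s ++ t) = reduce (s ++ t).
Proof. by rewrite /reduce !foldr_cat foldr_reduce // reduce_reduced. Qed.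

Lemma reduce_catr s t : reduce (s ++ reduce t) = reduce (s ++ t).
Proof. by rewrite /reduce !foldr_cat foldr_reduce. Qed.

Lemma winvK : involutive winv.
Proof. by move=> s; rewrite /winv map_rev revK mapK //; apply: linvK. Qed.

Lemma winv_reduced s : reduced s -> reduced (winv s).
Proof.
rewrite /reduced /winv rev_sorted sorted_map => rs.
by apply: sub_sorted rs => x y /=; rewrite linvK eq_sym.
Qed.

Lemma reduce_winv s : reduce (winv s ++ s) = [::].
Proof.
elim: s => //= x s IH; rewrite /winv /= rev_cons cat_rcons.
rewrite -reduce_catr /= -{2}[x]linvK cons_redK ?reduce_reduced //.
by rewrite reduce_catr.
Qed.

End Words.

Record free_group (n : nat) :=
  FreeGroup { word : seq ('I_n * bool); _ : reduced word }.

HB.instance Definition _ n := [isSub for @word n].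
HB.instance Definition _ n := [Choice of free_group n by <:].

Section FreeGroup.
Variable n : nat.
Implicit Types x y z : free_group n.

Definition fg_one : free_group n := @FreeGroup n [::] isT.
Definition fg_mul x y := FreeGroup (reduce_reduced (word x ++ word y)).
Definition fg_inv x := FreeGroup (winv_reduced (valP x)).

Fact fg_mulA : associative fg_mul.
Proof.
by move=> x y z; apply: val_inj; rewrite /= reduce_catl reduce_catr catA.
Qed.
Fact fg_mul1 : left_id fg_one fg_mul.
Proof. by move=> x; apply: val_inj; rewrite /= reduce_id //; apply: valP. Qed.
Fact fg_mulr1 : right_id fg_one fg_mul.
Proof.
by move=> x; apply: val_inj; rewrite /= cats0 reduce_id //; apply: valP.
Qed.
Fact fg_mulV : left_inverse fg_one fg_inv fg_mul.
Proof. by move=> x; apply: val_inj; rewrite /= reduce_winv. Qed.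
Fact fg_mulrV : right_inverse fg_one fg_inv fg_mul.
Proof.
by move=> x; apply: val_inj; rewrite /= -{1}[word x]winvK reduce_winv.
Qed.

HB.instance Definition _ :=
  isGroup.Build (free_group n) fg_mulA fg_mul1 fg_mulr1 fg_mulV fg_mulrV.

Definition letter (l : 'I_n * bool) : free_group n := @FreeGroup n [:: l] isT.
Definition gen (i : 'I_n) : free_group n := letter (i, true).

Lemma word1 : word (1%g : free_group n) = [::]. Proof. by []. Qed.
Lemma wordM x y : word (x * y)%g = reduce (word x ++ word y). Proof. by []. Qed.
Lemma wordV x : word (x^-1)%g = winv (word x). Proof. by []. Qed.
Lemma letter_inv i : letter (i, false) = (gen i)^-1%g.
Proof. exact: val_inj. Qed.

Definition wlen x : nat := size (word x).

End FreeGroup.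

(* The universal property: maps from the generators to a group extend         *)
(* uniquely to morphisms.                                                     *)
Section Extend.
Variables (n : nat) (H : groupType) (f : 'I_n -> H).

Definition letter_val (l : 'I_n * bool) : H :=
  (if l.2 then f l.1 else (f l.1)^-1)%g.
Definition word_val (s : seq ('I_n * bool)) : H :=
  (\prod_(l <- s) letter_val l)%g.
Definition extend (x : free_group n) : H := word_val (word x).

Lemma letter_valV l : letter_val (linv l) = (letter_val l)^-1%g.
Proof. by case: l => i []; rewrite /letter_val //= invgK. Qed.

Lemma word_val_reduce s : word_val (reduce s) = word_val s.
Proof.
elim: s => //= x s IH; rewrite {2}/word_val big_cons -/(word_val s) -IH.
case: (reduce s) => [|y r] /=; first by rewrite /word_val big_cons.
case: ifP => [/eqP-> | _]; last by rewrite /word_val big_cons.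
by rewrite /word_val big_cons letter_valV mulVKg.
Qed.

Fact extendM : {morph extend : x y / (x * y)%g}.
Proof.
by move=> x y; rewrite /extend wordM word_val_reduce /word_val big_cat.
Qed.
HB.instance Definition _ := isMultiplicative.Build (free_group n) H extend extendM.

Lemma extend_gen i : extend (gen i) = f i.
Proof. by rewrite /extend /word_val big_seq1. Qed.

Lemma extend_unique (phi : {multiplicative free_group n -> H}) :
  (forall i, phi (gen i) = f i) -> phi =1 extend.
Proof.
move=> phiE; have phi1 : phi 1%g = 1%g.
  by apply: (mulgI (phi 1%g)); rewrite -gmulfM !mulg1.
have phiV x : phi x^-1%g = (phi x)^-1%g.
  by apply: (mulgI (phi x)); rewrite -gmulfM !mulgV.
case=> s rs; rewrite /extend /=.
elim: s rs => [|l s IH] rs.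
  by rewrite /word_val big_nil -phi1; congr (phi _); apply: val_inj.
have rs' := reduced_behead rs.
have -> : FreeGroup rs = (letter l * FreeGroup rs')%g.
  by apply: val_inj; rewrite -[RHS]/(reduce (l :: s)) reduce_id.
rewrite gmulfM IH /word_val big_cons; congr (_ * _)%g.
by case: l {rs} => i []; rewrite ?letter_inv ?phiV phiE.
Qed.

End Extend.

Section Density.
Variables (n : nat) (R : realType).
Local Open Scope classical_set_scope.
Local Open Scope ring_scope.

(* G_p^n *)
Definition ball_pow (p : nat) : set {ffun 'I_n -> free_group n} :=
  [set t | forall i, (wlen (t i) <= p)%N].

Lemma finite_ball_pow p : finite_set (ball_pow p).
Proof.
pose F := {ffun 'I_n -> p.-bseq ('I_n * bool)}.
pose g (h : F) : {ffun 'I_n -> free_group n} :=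
  [ffun i => FreeGroup (reduce_reduced (h i))].
apply: (@sub_finite_set _ _ (g @` setT)); last first.
  by apply: finite_image; apply: finite_finset.
move=> t tp; exists [ffun i => Bseq (tp i)] => //.
apply/ffunP => i; rewrite !ffunE; apply: val_inj => /=.
by rewrite reduce_id //; apply: valP.
Qed.

Definition tuple_of_endo (phi : {multiplicative free_group n -> free_group n}) :
  {ffun 'I_n -> free_group n} := [ffun i => phi (gen i)].

(* |S \cap G_p^n| / |G_p^n|; both sets are finite by finite_ball_pow, so      *)
(* fset_set returns them unchanged.                                           *)
Definition density_seq (S : set {ffun 'I_n -> free_group n}) (p : nat) : R :=
  #|` fset_set (S `&` ball_pow p)|%:R / #|` fset_set (ball_pow p)|%:R.

End Density.

Section LSet.
Variable n : nat.
Local Notation G := (free_group n).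
Local Open Scope group_scope.
Implicit Type phi : {multiplicative G -> G}.

(* (w, w') are the tails of the occurrence (i, e) in phi(a_i) = v a_i^e v'. *)
Definition wagner_tails phi (i : 'I_n) (w w' : G) : Prop :=
  exists (v v' : G) (e : bool),
    word (phi (gen i)) = word v ++ (i, e) :: word v' /\
    (w, w') = if e then (v, v'^-1) else (v * (gen i)^-1, v'^-1 * gen i).

Definition w_nontrivial phi : Prop :=
  forall (i : 'I_n) (w w' : G), wagner_tails phi i w w' -> w <> 1 /\ w' <> 1.

Definition gen_free (k : 'I_n) (u : G) : Prop :=
  forall e : bool, (k, e) \notin word u.

(* In the four types below, [u] plays the role of phi(a_k), [s] of s_k, [l]   *)
(* of l_k.  Equating the words themselves, rather than the group elements,    *)
(* expresses that the products are reduced.                                   *)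
Definition type0 (k : 'I_n) (u s l : G) : Prop :=
  [/\ s <> 1, gen_free k s, l <> 1, gen_free k l &
      exists (m : G) (e e' : bool),
        word u = word s ++ (k, e) :: word m ++ (k, e') :: word l^-1].

Definition type1a (k : 'I_n) (u s l : G) : Prop :=
  [/\ s = (gen k)^-1, l <> 1, gen_free k l &
      exists (m : G) (e : bool),
        word u = (k, false) :: word m ++ (k, e) :: word l^-1].

Definition type1b (k : 'I_n) (u s l : G) : Prop :=
  [/\ s <> 1, gen_free k s, l = gen k &
      exists (m : G) (e : bool),
        word u = word s ++ (k, e) :: word m ++ [:: (k, false)]].

Definition type2 (k : 'I_n) (u s l : G) : Prop :=
  [/\ s = (gen k)^-1, l = gen k &
      exists m : G, word u = (k, false) :: word m ++ [:: (k, false)]].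

Definition initial (r : nat) (u : G) : option (seq ('I_n * bool)) :=
  if (r <= wlen u)%N then Some (take r (word u)) else None.

(* s and l are determined by phi: each phi(a_k) has at most one of the types, *)
(* with unique s_k and l_k.                                                   *)
Definition Lset : set {multiplicative G -> G} :=
  [set phi | w_nontrivial phi /\
     exists s l : 'I_n -> G,
       (forall k, [\/ type0 k (phi (gen k)) (s k) (l k),
                      type1a k (phi (gen k)) (s k) (l k),
                      type1b k (phi (gen k)) (s k) (l k) |
                      type2 k (phi (gen k)) (s k) (l k)]) /\
       exists v : (2 * n).-tuple G,
         perm_eq v ([seq phi (gen k) | k <- enum 'I_n] ++
                    [seq (phi (gen k))^-1 | k <- enum 'I_n]) /\
         forall (i j : 'I_(2 * n)) (m : 'I_n), (j < i)%N ->
           (tnth v i = phi (gen m) ->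
              Some (word (s m)) <> initial (wlen (s m)) (tnth v j)) /\
           (tnth v i = (phi (gen m))^-1 ->
              Some (word (l m)) <> initial (wlen (l m)) (tnth v j))]%classic.

End LSet.

Section Bound.
Variables (R : realType) (n : nat).
Local Open Scope ring_scope.
Local Notation N := (n%:R : R).

Definition Kcoef (c b : nat) : R :=
  \prod_((c + b).+1 <= k < n.+1)
    ((4 * (N - 1) ^+ 4 - (8 * k%:R - 6) * (N - 1) ^+ 2
        + 4 * k%:R ^+ 2 - 6 * k%:R + 2)
     / (N * (N - 1) * (2 * N - 1) ^+ 2)).

Definition dstar : R :=
  \sum_(0 <= c < n.+1) \sum_(0 <= b < (n - c).+1)
    'C(n, c)%:R * 'C(n - c, b)%:R * 2 ^+ b
    * ((N - 1) / (N * (2 * N - 1) ^+ 2)) ^+ c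
    * Kcoef c b
    * \prod_(1 <= j < b.+1)
        ((2 * (N - 1) ^+ 2 - (2 * c%:R + b%:R + j%:R - 1))
         / (N * (2 * N - 1) ^+ 2)).

End Bound.

(* Main.v *)
Require Import Defs.
From mathcomp Require Import all_boot all_order all_algebra.
From mathcomp Require Import finmap zify ring lra.
From mathcomp Require Import all_classical all_reals all_analysis.
Import Order.TTheory GRing.Theory Num.Theory.
Import numFieldNormedType.Exports.
Local Open Scope classical_set_scope.
Local Open Scope ring_scope.

(** Write [m = n - 1] and [q = 2n - 1]. The words $\phi(a_k)$ and
$\phi(a_k)^{-1}$ fill [2n] slots, indexed by the letters [x]: slot [x] contains
$\phi(x)$. In this indexing the types become symmetric. Slot [x] must not start
with [x]; it is fixed if it starts with $x^{-1}$, and then its tail ($s_k$ or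
$l_k$) is the letter $x^{-1}$; otherwise it is free, and its tail is its stem,
the part before the first occurrence of $x^{\pm 1}$. Nontriviality of all Wagner
tails says exactly that no slot [x] starts with [x].

Take an ordering with the set [F] of fixed slots first. Tails of fixed slots are
distinct letters, so they cause no conflict among themselves. When a free slot
is filled after [t] others, its stem must not be a prefix of any of these [t]
words. Give an initial segment of length [l] the weight $q^{-l}$: the stems, each
with the letter $x^{\pm 1}$ behind it, that are prefixes of a given word have total weight at most
$\sum_{r \ge 1} 2 q^{-r-1} = 1/(mq)$ ([tcount_stem_prefix]), against the weight
$2m/q$ of all stems. So the choices left have weight at least
$(2m^2 - t)/(mq)$ ([tcount_free_ok]), and multiplying over the slots bounds the
number of good families of initial segments ([card_slot_families]). Conversely
two long enough ends leave the middle of a word almost free: asymptotically, a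
proportion of at least $(m/n) q^{-2R}$ of the words has two given ends of length [R]
([bcount_has_ends]). Summed over [F], the density is at least
$$(m/n)^n q^{-2n} \sum_F \prod_{t = |F|}^{2n-1} (2m^2 - t)/m ,$$
and this is $d_n^*$: a set [F] with [c] pairs of opposite slots and [b] unpaired
ones has [2c + b] elements, and the sum over [(c, b)] is collected by the
identity $(X^2 + 2X + 1)^n = (1 + X)^{2n}$ ([sum_trinomial], [dstarE]).

Only segments of a fixed length [r + 1] are inspected, so stems that are not
completed within the segment are lost; their proportion is at most [slot_error r],
which decays geometrically. For every [r] the estimate [density_seq_ge] holds for all
large radii, and the theorem follows by letting first the radius and then [r]
tend to infinity. The product bound needs positive factors, which holds for
$n \ge 3$; for [n = 2] the number $d_2^*$ is not positive ([dstar2_le0]). *)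

Set Implicit Arguments.
Unset Strict Implicit.
Unset Printing Implicit Defensive.

(** * Counting tuples and bounded sequences letter by letter *)

Section SeqCount.
Local Open Scope nat_scope.
Variable T : finType.
Implicit Types (P Q : pred (seq T)) (s t : seq T).

Definition tcount l P := #|[pred t : l.-tuple T | P t]|.

Definition bcount p P := #|[pred s : p.-bseq T | P s]|.

Lemma tcountE l P : tcount l P = \sum_(t : l.-tuple T) P t.
Proof. by rewrite /tcount -sum1_card big_mkcond. Qed.

Lemma bcountE p P : bcount p P = \sum_(s : p.-bseq T) P s.
Proof. by rewrite /bcount -sum1_card big_mkcond. Qed.

Lemma tcount0 P : tcount 0 P = P [::].
Proof.
rewrite tcountE (bigD1 [tuple]) //= big1 ?addn0 //.
by case=> -[].
Qed.

Lemma bcount0 P : bcount 0 P = P [::].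
Proof.
rewrite bcountE (bigD1 [bseq]) //= big1 ?addn0 //.
by case=> -[].
Qed.

Lemma tcountS l P : tcount l.+1 P = \sum_y tcount l (fun s => P (y :: s)).
Proof.
under eq_bigr do rewrite tcountE.
rewrite tcountE pair_bigA /=.
rewrite (reindex (fun yt : T * l.-tuple T => [tuple of yt.1 :: yt.2])) //=.
exists (fun t : l.+1.-tuple T => (thead t, [tuple of behead t])) => [[y t] _|t _].
  by congr pair; apply: val_inj.
by rewrite -tuple_eta.
Qed.

Lemma bcountS p P :
  bcount p.+1 P = P [::] + \sum_y bcount p (fun s => P (y :: s)).
Proof.
rewrite bcountE (bigD1 [bseq]) //=; congr (_ + _).
under [RHS]eq_bigr do rewrite bcountE.
rewrite pair_bigA /=.
pose f (yt : T * p.-bseq T) : p.+1.-bseq T := [bseq of yt.1 :: yt.2].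
pose g (s : p.+1.-bseq T) : option (T * p.-bseq T) :=
  if val s is y :: t then Some (y, insub_bseq p t) else None.
rewrite (reindex_omap f g) => [|[[|y s] ls] // _]; last first.
  by congr Some; apply: val_inj; rewrite /= insubdK.
by apply: eq_bigl => -[y s] /=; rewrite /g /= /insub_bseq valKd eqxx.
Qed.

Lemma leq_tcount l P Q : (forall s, size s = l -> P s -> Q s) ->
  tcount l P <= tcount l Q.
Proof.
move=> PQ; apply/subset_leq_card/fintype.subsetP => t; rewrite !inE; apply: PQ.
exact: size_tuple.
Qed.

Lemma eq_tcount l P Q : (forall s, size s = l -> P s = Q s) ->
  tcount l P = tcount l Q.
Proof.
by move=> PQ; apply: eq_card => t; rewrite !inE PQ ?size_tuple.
Qed.

Lemma eq_bcount l P Q : P =1 Q -> bcount l P = bcount l Q.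
Proof. by move=> PQ; apply: eq_card => t; rewrite !inE PQ. Qed.

Lemma leq_bcount l P Q : (forall s, P s -> Q s) -> bcount l P <= bcount l Q.
Proof. by move=> PQ; apply/subset_leq_card/fintype.subsetP => t; rewrite !inE; apply: PQ. Qed.

Lemma tcountID l P Q :
  tcount l P = tcount l (fun s => P s && Q s) + tcount l (fun s => P s && ~~ Q s).
Proof. by rewrite !tcountE -big_split; apply: eq_bigr => t _; case: (P t); case: (Q t). Qed.

Lemma tcountU l P Q :
  tcount l (fun s => P s || Q s) <= tcount l P + tcount l Q.
Proof.
by rewrite !tcountE -big_split; apply: leq_sum => t _; case: (P t); case: (Q t).
Qed.

Lemma bcountU l P Q : (forall s, P s -> ~~ Q s) ->
  bcount l (fun s => P s || Q s) = bcount l P + bcount l Q.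
Proof.
move=> PQ; rewrite !bcountE -big_split; apply: eq_bigr => t _ /=.
by have := PQ t; case: (P t) => [/(_ isT)/negPf->|_]; case: (Q t).
Qed.

Lemma tcount_false l P : (forall s, P s = false) -> tcount l P = 0.
Proof. by move=> P0; rewrite tcountE big1 // => t _; rewrite P0. Qed.

Lemma bcount_false l P : (forall s, P s = false) -> bcount l P = 0.
Proof. by move=> P0; rewrite bcountE big1 // => t _; rewrite P0. Qed.

Lemma bcount1 p s : size s <= p -> bcount p (pred1 s) = 1.
Proof.
move=> sp; rewrite /bcount -(card1 (Bseq sp)); apply: eq_card => t.
by rewrite !inE.
Qed.

(** Filling positions one by one: if after [i] admissible choices at least [N i]
remain, then the admissible tuples number at least the product. The head of
the sequence is the most recent choice. *)
Lemma tcount_sequential (R : numDomainType) (ok : pred (seq T))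
    (N : nat -> R) (k : nat) :
    ok [::] ->
    (forall i, (i < k)%N -> 0 <= N i)%R ->
    (forall s, size s < k -> ok s ->
       (N (size s) <= #|[pred w | ok (w :: s)]|%:R)%R) ->
  (\prod_(i < k) N i <= (tcount k ok)%:R)%R.
Proof.
elim: k => [|k IH] ok0 N0 Nok; first by rewrite big_ord0 tcount0 ok0.
rewrite big_ord_recr /= mulrC.
have {}IH := IH ok0 (fun i ik => N0 i (ltnW ik)) (fun s sk => Nok s (ltnW sk)).
apply: le_trans (ler_wpM2l (N0 k (ltnSn k)) IH) _.
rewrite tcountS; under eq_bigr do rewrite tcountE.
rewrite exchange_big /= tcountE !natr_sum mulr_sumr; apply: ler_sum => t _.
case okt: (ok t); last by rewrite mulr0.
rewrite mulr1; have := Nok t; rewrite size_tuple => /(_ (ltnSn k) okt) h.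
by apply: le_trans h _; rewrite ler_nat -sum1_card big_mkcond.
Qed.

End SeqCount.

(** Disjointness is witnessed by [h], which recovers the index. *)
Lemma sum_card_disjoint (I T : finType) (A : I -> {set T}) (B : {set T})
    (h : T -> I) :
    (forall i x, x \in A i -> x \in B /\ h x = i) ->
  (\sum_i #|A i| <= #|B|)%N.
Proof.
move=> AB; rewrite -[leqRHS]sum1_card (partition_big h predT) //=.
apply: leq_sum => i _; rewrite -[leqLHS]sum1_card [leqLHS]big_mkcond [leqRHS]big_mkcond /=.
by apply: leq_sum => x _; case: ifP => // /AB[-> ->]; rewrite eqxx.
Qed.

(** * Counting reduced words with prescribed ends *)

Section Words.
Variable n : nat.
Implicit Types s t : seq ('I_n * bool).

Lemma size_winv s : size (winv s) = size s.
Proof. by rewrite size_rev size_map. Qed.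

Lemma winv_cat s t : winv (s ++ t) = winv t ++ winv s.
Proof. by rewrite /winv map_cat rev_cat. Qed.

Lemma reduced_catl s t : reduced (s ++ t) -> reduced s.
Proof. by move/(take_sorted (size s)); rewrite take_size_cat. Qed.

Lemma reduced_catr s t : reduced (s ++ t) -> reduced t.
Proof. by move/(drop_sorted (size s)); rewrite drop_size_cat. Qed.

End Words.

Section WordCount.
Local Open Scope nat_scope.
Variable m : nat.
Local Notation n := m.+1.
Local Notation q := (2 * m).+1.
Local Notation L := ('I_n * bool)%type.
Implicit Types (x y z : L) (s t w : seq L) (k : 'I_n).

Local Notation next := (fun x y : L => y != linv x).

Lemma card_letter : #|{: L}| = q.+1.
Proof. by rewrite card_prod card_ord card_bool; lia. Qed.

Lemma card_neq x : #|[pred y : L | y != x]| = q.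
Proof. by have := cardC1 x; rewrite card_letter. Qed.

Lemma card_letter_of k : #|[pred y : L | y.1 == k]| = 2.
Proof.
transitivity #|[seq (k, b) | b : bool]|.
  apply: eq_card => -[i b]; rewrite !inE /=.
  by apply/eqP/fintype.imageP => [->|[c _ [-> _]] //]; exists b.
by rewrite fintype.card_image ?card_bool // => b c [].
Qed.

Lemma card_not_letter_of k : #|[pred y : L | y.1 != k]| = 2 * m.
Proof.
have := cardC [pred y : L | y.1 == k].
rewrite card_letter_of card_letter add2n => -[<-].
exact: eq_card.
Qed.

Lemma tcount_path l x : tcount l (path next x) = q ^ l.
Proof.
elim: l x => [|l IH] x; first by rewrite tcount0.
rewrite tcountS (bigID (fun y => y != linv x)) /= [X in _ + X]big1 => [|y /negbNE/eqP->].
  rewrite addn0 (eq_bigr (fun=> q ^ l)) => [|y yx].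
    by rewrite sum_nat_const card_neq expnS.
  by rewrite -(IH y); apply: eq_tcount => s _; rewrite yx.
by apply: tcount_false => s; rewrite eqxx.
Qed.

Lemma tcount_path_avoid l y k : y.1 != k ->
  tcount l (fun s => path next y s && ~~ has (fun a => a.1 == k) s)
    <= (2 * m).-1 ^ l.
Proof.
elim: l y => [|l IH] y yk; first by rewrite tcount0.
rewrite tcountS (bigID (fun z => (z.1 != k) && (z != linv y))) /=.
rewrite [X in _ + X]big1 => [|z]; last first.
  rewrite negb_and !negbK => zky; apply: tcount_false => s /=.
  by case/orP: zky => ->; rewrite ?andbF.
rewrite addn0 expnS.
have c : (2 * m).-1 = #|[pred z : L | (z.1 != k) && (z != linv y)]|.
  have := cardD1 (linv y) [pred z : L | z.1 != k].
  rewrite card_not_letter_of !inE yk => ->; rewrite add1n /=.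
  by apply: eq_card => z; rewrite !inE andbC.
rewrite [X in X * _]c -sum_nat_const; apply: leq_sum => z /andP[zk zy].
apply: leq_trans (IH z zk); apply: leq_tcount => s _ /=.
by rewrite zy (negPf zk).
Qed.

Lemma tcount_has l (P : pred (seq L)) (Q : seq L -> pred (seq L)) ws :
  tcount l (fun s => P s && has (Q s) ws)
    <= \sum_(w <- ws) tcount l (fun s => P s && Q s w).
Proof.
elim: ws => [|w ws IH]; first by rewrite tcount_false // => s; rewrite andbF.
rewrite big_cons; apply: leq_trans (leq_add (leqnn _) IH).
by apply: leq_trans (tcountU _ _ _); apply: leq_tcount => s _ /=; rewrite andb_orr.
Qed.

(** This is $s_k$ or $l_k$ for a word starting with a letter other than $a_k^{\pm 1}$. *)
Definition stem k s := take (find (fun a : L => a.1 == k) s) s.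

Lemma sum_ohead (f : L -> nat) w : \sum_y (ohead w == Some y) * f y =
  if w is y :: _ then f y else 0.
Proof.
case: w => [|y w] /=; first by rewrite big1.
rewrite (bigD1 y) //= eqxx mul1n big1 ?addn0 // => z zy.
by rewrite -[_ == _]/(y == z) eq_sym (negPf zy).
Qed.

(** A prefix of [w] is determined by its length, so each further letter of the
stem costs a factor [q]: the counts [2 * q ^ i] for [i < l] add up to
$(q^l - 1)/m$. The stem may be empty here, because the first letter of the
full word has already been split off. *)
Lemma tcount_stem_prefix l y k w :
  m * tcount l (fun s => [&& path next y s, has (fun a => a.1 == k) s
                           & prefix (stem k s) w]) < q ^ l.
Proof.
elim: l y w => [|l IH] y w; first by rewrite tcount0 muln0.
pose X := \sum_z (ohead w == Some z) *
  tcount l (fun s => [&& path next z s, has (fun a => a.1 == k) s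
                           & prefix (stem k s) (behead w)]).
have mX : m * X < q ^ l.
  rewrite /X sum_ohead; case: w {X} => [|z w]; last exact: IH.
  by rewrite muln0 expn_gt0.
apply: (@leq_ltn_trans (m * (2 * q ^ l + X))); last by rewrite expnS; nia.
rewrite leq_mul2l tcountS; apply/orP; right.
rewrite -[X in X * q ^ l](card_letter_of k) -sum_nat_const [X in X + _]big_mkcond /X -big_split /=.
apply: leq_sum => z _; rewrite inE; case: ifP => zk.
  apply: leq_trans (leq_addr _ _); rewrite -(tcount_path l z).
  by apply: leq_tcount => s _ /=; case/andP=> /andP[].
rewrite add0n; case: (ohead w =P Some z) => [wz|wz]; last first.
  rewrite /= mul0n tcount_false // => s; rewrite /stem /= zk /=.
  case: w wz {mX X} => [|z' w] /= wz; first by rewrite !andbF.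
  by case: (z =P z') => [zz|]; rewrite ?andbF //; case: wz; rewrite zz.
rewrite mul1n; apply: leq_tcount => s _; rewrite /stem /= zk /=.
by case: w wz {mX X} => //= z' w [->]; rewrite eqxx /= -!andbA => /and4P[_ -> -> ->].
Qed.

(** The requirements on the initial segment of a free slot for [k]: the stem is
nonempty and completed inside the segment, and it is not a prefix of any of the
previously chosen segments [ws]. *)
Definition free_ok k ws s :=
  [&& reduced s, 0 < find (fun a => a.1 == k) s < size s
    & ~~ has (prefix (stem k s)) ws].

(** Union bound: among the reduced words that start with a letter other than
$a_k^{\pm 1}$, those to be removed avoid $a_k^{\pm 1}$ or have a stem that is a
prefix of one of the words [ws]. *)
Lemma tcount_free_ok r k ws :
  2 * m ^ 2 * q ^ r <= m * tcount r.+1 (free_ok k ws)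
     + 2 * m ^ 2 * (2 * m).-1 ^ r + size ws * q ^ r.
Proof.
pose B y w := tcount r (fun s => [&& path next y s, has (fun a => a.1 == k) s
                           & prefix (stem k s) (behead w)]).
pose C y := \sum_(w <- ws) (ohead w == Some y) * B y w.
have mC : m * \sum_y C y <= size ws * q ^ r.
  rewrite exchange_big /= big_distrr /= -sum1_size big_distrl /=.
  apply: leq_sum => w _; rewrite mul1n sum_ohead.
  by case: w => [|y w]; rewrite ?muln0 // ltnW // tcount_stem_prefix.
have H y : y.1 != k ->
  q ^ r <= tcount r (fun s => free_ok k ws (y :: s)) + (2 * m).-1 ^ r + C y.
  move=> yk; rewrite -(tcount_path r y).
  rewrite (tcountID _ _ (has (fun a => a.1 == k))).
  rewrite addnAC leq_add ?tcount_path_avoid //.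
  rewrite (tcountID _ _ (fun s => ~~ has (prefix (y :: stem k s)) ws)).
  apply: leq_add.
    apply: leq_tcount => s _ /=.
    by rewrite /free_ok /stem /= (negPf yk) /= ltnS -has_find -andbA.
  apply: (@leq_trans (tcount r (fun s => (path next y s && has (fun a => a.1 == k) s)
       && has (prefix (y :: stem k s)) ws))).
    by apply: leq_tcount => s _; rewrite negbK.
  apply: leq_trans (tcount_has _ _ _ _) _; apply: leq_sum => w _.
  case: w => [|z w]; first by rewrite tcount_false // => s; rewrite andbF.
  rewrite -[ohead _ == _]/(z == y) eq_sym; case: eqP => [<-|yz]; last first.
    by rewrite tcount_false // => s /=; case: eqP yz; rewrite ?andbF.
  by rewrite mul1n; apply: leq_tcount => s _ /=; rewrite eqxx -andbA.
have : \sum_(y : L | y.1 != k) q ^ r <= tcount r.+1 (free_ok k ws)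
     + 2 * m * (2 * m).-1 ^ r + \sum_y C y.
  apply: (@leq_trans (\sum_(y : L | y.1 != k) (tcount r (fun s => free_ok k ws (y :: s)) + (2 * m).-1 ^ r + C y))).
    exact: leq_sum.
  rewrite !big_split /= !sum_nat_const.
  rewrite card_not_letter_of !leq_add //.
    by rewrite tcountS [leqRHS](bigID (fun y => y.1 != k)) leq_addr.
  by rewrite [leqRHS](bigID (fun y => y.1 != k)) leq_addr.
rewrite sum_nat_const card_not_letter_of => h.
apply: leq_trans (leq_add (leqnn _) mC).
by have := leq_mul (leqnn m) h; lia.
Qed.

Lemma tcount_head r z :
  tcount r.+1 (fun s => reduced s && (ohead s == Some z)) = q ^ r.
Proof.
rewrite tcountS (bigD1 z) //= big1 ?addn0 => [|y yz]; last first.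
  by apply: tcount_false => s; rewrite [_ == _](negPf yz) andbF.
by rewrite -(tcount_path r z); apply: eq_tcount => s _; rewrite eqxx andbT.
Qed.

Lemma bcount_path p x : (2 * m * bcount p (path next x)).+1 = q ^ p.+1.
Proof.
elim: p x => [|p IH] x; first by rewrite bcount0 muln1 expn1.
rewrite bcountS /= (bigID (fun y => y != linv x)) /=.
rewrite [X in _ + (_ + X)]big1 => [|y /negbNE/eqP->]; last first.
  by apply: bcount_false => s; rewrite eqxx.
rewrite addn0 mulnDr big_distrr /=.
rewrite (eq_bigr (fun=> (q ^ p.+1).-1)) => [|y yx]; last first.
  by rewrite -(IH y) /=; congr (_ * _); apply: eq_bcount => s; rewrite yx.
rewrite sum_nat_const card_neq [q ^ p.+2]expnS muln1.
have : 0 < q ^ p.+1 by rewrite expn_gt0.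
by case: (q ^ p.+1) => // a _ /=; lia.
Qed.

Lemma bcount_reduced p : m * bcount p (@reduced n) <= n * q ^ p.
Proof.
case: p => [|p]; first by rewrite bcount0 /=; lia.
have B y : 2 * m * bcount p (fun s => reduced (y :: s)) = (q ^ p.+1).-1.
  by rewrite -(bcount_path p y).
rewrite bcountS /= -(leq_pmul2l (isT : 0 < 2)) mulnA mulnDr big_distrr /=.
under eq_bigr do rewrite B.
rewrite sum_nat_const cardT -cardE card_letter.
have : 0 < q ^ p.+1 by rewrite expn_gt0.
by case: (q ^ p.+1) => // a _ /=; lia.
Qed.

(** Of the [2 * m] or more letters that may precede [Q], each gives one word
ending at once; the other words come from the induction hypothesis after one of
[q] letters. So the count obeys [K (p + 1) >= q * K p + (q - 1)]. *)
Lemma bcount_suffix p x Q : 0 < size Q -> reduced Q ->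
  q ^ p <= (bcount (p + size Q)
     (fun t => [&& path next x t, size Q < size t & suffix Q t])).+1.
Proof.
case: Q => // z Q _ rQ; elim: p x => [|p IH] x; first by [].
rewrite addSn bcountS.
rewrite /= add0n.
set N := p + _.
have H y : (y != linv x) && (y != linv z) + (y != linv x) * (q ^ p).-1 <=
  bcount N (fun t => [&& (y != linv x) && path next y t, (size Q).+1 < (size t).+1 & suffix (z :: Q) (y :: t)]).
  case: (altP (y =P linv x)) => //= yx; rewrite mul1n.
  apply: (@leq_trans (bcount N (fun t => ((y != linv z) && (t == z :: Q)) || [&& path next y t, (size Q).+1 < size t & suffix (z :: Q) t]))).
    rewrite bcountU => [|t /andP[_ /eqP->]]; last by rewrite /= ltnn andbF.
    apply: leq_add; last by rewrite -subn1 leq_subLR add1n IH.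
    by case: (y != linv z) => //=; rewrite bcount1 // leq_addl.
  apply: leq_bcount => t /orP[/andP[yz /eqP->]|/and3P[-> tQ sQ]] /=.
    rewrite -/(reduced (z :: Q)) -[path _ _ _]/(reduced (z :: Q)) rQ ltnS leqnn.
    rewrite -[y :: z :: Q]cat1s suffix_suffix !andbT; apply: contra yz => /eqP->.
    by rewrite linvK.
  by rewrite ltnS (ltnW tQ) -[y :: t]cat1s suffix_catr.
apply: leq_trans (_ : q ^ p.+1 <= (\sum_y ((y != linv x) && (y != linv z) + (y != linv x) * (q ^ p).-1)).+1) _; last first.
  by rewrite ltnS; apply: leq_sum => y _; apply: H.
rewrite big_split /= -big_distrl /=.
have -> : \sum_y nat_of_bool (y != linv x) = q.
  by rewrite -[RHS](card_neq (linv x)) -sum1_card [RHS]big_mkcond.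
have : 2 * m <= \sum_(y : L) ((y != linv x) && (y != linv z)).
  have := cardD1 (linv z) [pred y | y != linv x].
  rewrite card_neq /= => h.
  have -> : \sum_(y : L) ((y != linv x) && (y != linv z)) =
     #|[predD1 [pred y | y != linv x] & linv z]|.
    by rewrite -sum1_card [RHS]big_mkcond; apply: eq_bigr => y _; rewrite !inE andbC; case: (_ && _).
  rewrite -ltnS [X in X <= _]h.
  by case: (_ \in _); rewrite ?add1n ?add0n // leqnSn.
have : 0 < q ^ p by rewrite expn_gt0.
rewrite expnS; case: (q ^ p) => // a _ /=.
by rewrite mulnS -addSn leq_add2r ltnS.
Qed.

Lemma bcount_cat p P (Phi : pred (seq L)) :
  bcount p (fun t => Phi (P ++ t)) <= bcount (size P + p) Phi.
Proof.
elim: P Phi => //= y P IH Phi.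
apply: leq_trans (IH (fun s => Phi (y :: s))) _.
by rewrite addSn bcountS (bigD1 y) //= addnCA leq_addr.
Qed.

Definition has_ends r P Q s :=
  [&& reduced s, 2 * r < size s, take r s == P & take r (winv s) == Q].

(** Removing the prefix [P] leaves the words after the last letter of [P] that end
in [winv Q] with at least one letter in between. *)
Lemma bcount_has_ends r p P Q : 0 < r -> 2 * r <= p ->
    size P = r -> reduced P -> size Q = r -> reduced Q ->
  q ^ (p - 2 * r) <= (bcount p (has_ends r P Q)).+1.
Proof.
move=> r0 rp sP rP sQ rQ; have -> : p = size P + (p - 2 * r + size (winv Q)).
  by rewrite size_winv sP sQ; lia.
case/lastP: P => [|P x] in sP rP *; first by move: r0; rewrite -sP.
apply: leq_trans (bcount_suffix _ x _ (winv_reduced rQ)) _.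
  by rewrite size_winv sQ.
rewrite !ltnS; have -> : size (rcons P x) + (p - 2 * r + size (winv Q)) - 2 * r
   = p - 2 * r by rewrite size_winv sP sQ; lia.
apply: leq_trans (bcount_cat _ _ _); apply: leq_bcount => t /and3P[pt st /suffixP[u tE]].
have st' : size t = size u + r by rewrite tE size_cat size_winv sQ.
rewrite /has_ends; apply/and4P; split.
- move: rP; case: P {sP} => [|y P] /=; first by [].
  by rewrite rcons_path cat_path last_rcons rcons_path => -> /=.
- by move: st; rewrite size_cat sP size_winv sQ; lia.
- by rewrite take_size_cat.
- by rewrite tE 2!winv_cat winvK -catA take_size_cat.
Qed.

End WordCount.

(** * Choosing the initial segments of the slots one after the other *)

Section SetLast.
Local Open Scope nat_scope.
Variables (T : finType) (F : {set T}).

(** Lists of slots are read from the end, so the elements of [F] are chosen first. *)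
Definition set_last := enum (~: F) ++ enum F.

Lemma set_last_uniq : uniq set_last.
Proof.
rewrite cat_uniq !enum_uniq andbT /=; apply/hasPn => x.
by rewrite !mem_enum inE negbK.
Qed.

Lemma mem_set_last x : x \in set_last.
Proof. by rewrite mem_cat !mem_enum inE orNb. Qed.

Lemma size_set_last : size set_last = #|T|.
Proof. by rewrite size_cat -!cardE addnC cardsC. Qed.

Lemma nth_set_last x0 i : i < #|T| ->
  (nth x0 set_last (#|T| - i.+1) \in F) = (i < #|F|).
Proof.
have := size_set_last; rewrite size_cat (cardE F) nth_cat => <- iT.
set N := _ + _ in iT *; have NE : N = size (enum (~: F)) + size (enum F) by [].
case: (ltnP (N - i.+1)) => h.
  have := mem_nth x0 h; rewrite mem_enum inE => /negPf->.
  by apply/esym/negbTE; rewrite -leqNgt; lia.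
set j := _ - _; have h' : j < size (enum F) by rewrite /j; lia.
by have := mem_nth x0 h'; rewrite mem_enum => ->; apply/esym; lia.
Qed.

End SetLast.

Section GoodPrefixes.
Local Open Scope nat_scope.
Variable m : nat.
Local Notation n := m.+1.
Local Notation q := (2 * m).+1.
Local Notation L := ('I_n * bool)%type.
Implicit Types (F : {set L}) (x y : L) (xs : seq L) (w : seq L) (ws : seq (seq L)).

(** [F] is the set of fixed slots. *)
Definition slot_ok F x ws w :=
  if x \in F then reduced w && (ohead w == Some (linv x))
  else free_ok x.1 ws w.

(** The slots are listed in the reverse order of choice: the tail of the list has
been filled before its head. *)
Fixpoint slots_ok F xs ws := match xs, ws with
  | [::], [::] => true
  | x :: xs', w :: ws' => slot_ok F x ws' w && slots_ok F xs' ws'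
  | _, _ => false
  end.

Lemma size_letters_set_last F : size (set_last F) = 2 * n.
Proof. by rewrite size_set_last card_letter; lia. Qed.

Lemma nth_letters_set_last F x0 i : i < 2 * n ->
  (nth x0 (set_last F) (2 * n - i.+1) \in F) = (i < #|F|).
Proof.
by have := @nth_set_last _ F x0 i; have -> : #|{: L}| = 2 * n by rewrite card_letter; lia.
Qed.

Definition slot_families r F :=
  [set d : {ffun L -> r.+1.-tuple L} |
     slots_ok F (set_last F) [seq val (d x) | x <- set_last F]]%SET.
Section Lower.
Local Open Scope ring_scope.
Variable R : realFieldType.
Local Notation M := (m%:R : R).

(** The guaranteed number of segments for a free slot after [i] others, in units of
[q ^ r] for segments of length [r + 1] and up to the factor [1 - slot_error r]. A
fixed slot has [q ^ r] segments, hence weight [1]. *)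
Definition slot_weight (i : nat) : R := (2 * M ^+ 2 - i%:R) / M.

(** A bound for the relative loss due to the segments that never meet $a_k^{\pm 1}$. *)
Definition slot_error (r : nat) : R :=
  2 * M ^+ 2 * ((2 * m).-1%:R / q%:R) ^+ r.

Lemma slot_weight_gt0 i : (2 <= m)%N -> (i < 2 * n)%N -> 0 < slot_weight i.
Proof.
move=> m2 i2n; rewrite /slot_weight divr_gt0 ?ltr0n ?(ltn_trans _ m2) //.
by rewrite -natrX -natrM subr_gt0 ltr_nat; nia.
Qed.

(** The lost segments number at most [2 * m * (2 * m - 1) ^ r]; since the integer
[2 * m ^ 2 - size ws] is at least [1], this is the fraction [slot_error r] of the main
term or less. *)
Lemma tcount_free_ok_weight r k (ws : seq (seq L)) : (2 <= m)%N ->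
    (size ws < 2 * n)%N ->
  q%:R ^+ r * (1 - slot_error r) * slot_weight (size ws)
    <= (tcount r.+1 (free_ok k ws))%:R.
Proof.
move=> m2 ws2n; have := tcount_free_ok r k ws.
set T := tcount _ _; rewrite -(ler_nat R) !natrD !natrM !natrX => H.
have m0 : 0 < M by rewrite ltr0n (ltn_trans _ m2).
have q0 : 0 < q%:R ^+ r :> R by rewrite exprn_gt0 ?ltr0n.
rewrite /slot_weight mulrA ler_pdivrMr // [_ * M]mulrC.
apply: le_trans (_ : 2 * M ^+ 2 * q%:R ^+ r - 2 * M ^+ 2 * (2 * m).-1%:R ^+ r
   - (size ws)%:R * q%:R ^+ r <= _); last by lra.
rewrite /slot_error exprMn exprVn.
have -> : q%:R ^+ r * (1 - 2 * M ^+ 2 * ((2 * m).-1%:R ^+ r / q%:R ^+ r)) =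
  q%:R ^+ r - 2 * M ^+ 2 * (2 * m).-1%:R ^+ r :> R by field; lra.
have h1 : (size ws).+1%:R <= 2 * M ^+ 2 by rewrite -natrX -natrM ler_nat; nia.
have h2 : 0 <= 2 * M ^+ 2 * (2 * m).-1%:R ^+ r :> R.
  by rewrite !mulr_ge0 ?exprn_ge0 ?ler0n.
rewrite -natr1 in h1; nra.
Qed.

(** The slots of [F] are filled first, at positions [i < #|F|] of the order of
choice, and contribute the factor [1]. *)
Lemma card_slot_families r F : (2 <= m)%N -> slot_error r <= 1 ->
  (q%:R ^+ r * (1 - slot_error r)) ^+ (2 * n)
     * \prod_(#|F| <= i < 2 * n) slot_weight i
    <= #|slot_families r F|%:R.
Proof.
move=> m2 e1; pose T : finType := r.+1.-tuple L.
pose x0 : L := (ord0, true).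
pose w0 : T := [tuple of nseq r.+1 x0].
pose ok (s : seq T) :=
  slots_ok F (drop (2 * n - size s) (set_last F)) (map val s).
pose c := q%:R ^+ r * (1 - slot_error r).
have e0 : 0 <= slot_error r.
  by rewrite !mulr_ge0 ?exprn_ge0 ?divr_ge0 ?ler0n.
have c0 : 0 <= c by rewrite mulr_ge0 ?exprn_ge0 ?subr_ge0.
have cq : c <= q%:R ^+ r by rewrite ler_piMr ?exprn_ge0 ?gerBl.
pose N i := c * if (i < #|F|)%N then 1 else slot_weight i.
have F2n : (#|F| <= 2 * n)%N by have := max_card F; rewrite card_letter; lia.
have step s : (size s < 2 * n)%N -> ok s ->
    N (size s) <= #|[pred w | ok (w :: s)]|%:R.
  move=> s2n oks; set x := nth x0 (set_last F) (2 * n - (size s).+1).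
  have okE (w : T) : ok (w :: s) = slot_ok F x (map val s) (val w).
    rewrite /ok /= (drop_nth x0) ?size_letters_set_last; last by lia.
    have -> : (2 * n - (size s).+1).+1 = (2 * n - size s)%N by lia.
    by rewrite /= -/(ok s) oks andbT.
  have -> : #|[pred w | ok (w :: s)]| = tcount r.+1 (slot_ok F x (map val s)).
    by apply: eq_card => w; rewrite !inE okE.
  rewrite /N /slot_ok nth_letters_set_last //; case: ifP => _.
    by rewrite tcount_head mulr1 natrX.
  rewrite -(size_map val s); apply: tcount_free_ok_weight => //.
  by rewrite size_map.
apply: le_trans (_ : (tcount (2 * n) ok)%:R <= _).
  have N0 i : (i < 2 * n)%N -> 0 <= N i.
    move=> i2n; rewrite /N mulr_ge0 //; case: ifP => // _.
    by rewrite ltW ?slot_weight_gt0.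
  apply: le_trans (tcount_sequential _ N0 step); last first.
    by rewrite /ok subn0 drop_oversize ?size_letters_set_last.
  rewrite [leRHS]big_split /= prodr_const card_ord ler_wpM2l ?exprn_ge0 //.
  rewrite -(big_mkord predT (fun i => if (i < #|F|)%N then 1 else slot_weight i)).
  rewrite [leRHS](big_cat_nat _ F2n) //= [X in X * _]big_nat [X in X * _]big1 => [|i /andP[_ ->] //].
  rewrite mul1r big_nat [leRHS]big_nat le_eqVlt; apply/orP; left; apply/eqP.
  by apply: eq_bigr => i /andP[Fi _]; rewrite ltnNge Fi.
rewrite ler_nat /tcount.
pose f (t : (2 * n).-tuple T) : {ffun L -> T} :=
  [ffun x => nth w0 t (index x (set_last F))].
have fE (t : (2 * n).-tuple T) : [seq f t x | x <- set_last F] = t.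
  apply: (@eq_from_nth _ w0) => [|i]; rewrite size_map size_letters_set_last ?size_tuple //.
  move=> i2n; rewrite (nth_map x0) ?size_letters_set_last // ffunE.
  by rewrite index_uniq ?set_last_uniq ?size_letters_set_last.
rewrite -(card_in_imset (f := f) (D := [pred t : (2 * n).-tuple T | ok t])) => [|t t' _ _ tt']; last first.
  by apply: val_inj; rewrite /= -fE tt' fE.
apply/subset_leq_card/fintype.subsetP => _ /imsetP[t okt ->].
move: okt; rewrite !inE /ok size_tuple subnn drop0.
by rewrite -{1}[val t]fE -map_comp.
Qed.

End Lower.

Lemma slots_ok_split F xs (d : L -> seq L) (x : L) xs1 xs2 :
  slots_ok F xs (map d xs) -> xs = xs1 ++ x :: xs2 ->
  slot_ok F x (map d xs2) (d x).
Proof.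
by move=> + xsE; rewrite {}xsE; elim: xs1 => [|y xs1 IH] /= /andP[].
Qed.

End GoodPrefixes.

(** * Counting the tuples of words with good initial segments *)

Section GoodTuples.
Local Open Scope nat_scope.
Variable m : nat.
Local Notation n := m.+1.
Local Notation q := (2 * m).+1.
Local Notation L := ('I_n * bool)%type.
Implicit Types (F : {set L}) (x y : L) (w : seq L) (ws : seq (seq L)).

Lemma slot_ok_reduced F x ws w : slot_ok F x ws w -> reduced w.
Proof. by rewrite /slot_ok; case: ifP => _; [case/andP | case/and3P]. Qed.

Lemma slot_ok_head F x ws w :
  slot_ok F x ws w -> (ohead w == Some (linv x)) = (x \in F).
Proof.
rewrite /slot_ok; case: ifP => [_ /andP[_ ->] // | _ /and3P[_ wx _]].
case: w wx => //= y w; case: ifP => // yx _.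
by apply/eqP => -[yE]; rewrite yE /= eqxx in yx.
Qed.

Variables p r : nat.
Local Notation W := (r.+1.-tuple L).
Local Notation U := {ffun 'I_n -> p.-bseq L}.

Lemma slot_families_ok F (d : {ffun L -> W}) x : d \in slot_families r F ->
  exists ws, slot_ok F x ws (d x).
Proof.
rewrite inE => dF; have xF := mem_set_last F x.
case/splitPr E : _ / xF => [xs1 xs2].
by exists (map (fun y => val (d y)) xs2); apply: slots_ok_split dF E.
Qed.

Definition slot_class (d : {ffun L -> W}) : {set U} :=
  [set u : U | [forall k, has_ends r.+1 (d (k, true)) (d (k, false)) (u k)]]%SET.

Definition slot_word (u : U) x :=
  if x.2 then val (u x.1) else winv (val (u x.1)).

Lemma slot_classP (d : {ffun L -> W}) (u : U) : u \in slot_class d ->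
  forall x, take r.+1 (slot_word u x) = d x.
Proof.
rewrite inE => /forallP du [k b]; have /and4P[_ _ /eqP d1 /eqP d2] := du k.
by case: b; rewrite /slot_word.
Qed.

(** The two slots of a generator are the two ends of one word, and the words of
different generators are independent. *)
Lemma card_slot_class F (d : {ffun L -> W}) : 2 * r.+1 <= p ->
  d \in slot_families r F -> (q ^ (p - 2 * r.+1)).-1 ^ n <= #|slot_class d|.
Proof.
move=> rp dF.
have rd x : reduced (d x).
  by have [ws /slot_ok_reduced] := slot_families_ok x dF.
pose A (k : 'I_n) := [pred s : p.-bseq L | has_ends r.+1 (d (k, true)) (d (k, false)) s].
have -> : #|slot_class d| = #|family A|.
  by apply: eq_card => u; rewrite inE; apply: eq_forallb => k; rewrite inE.
rewrite card_family foldrE big_map -[X in _ ^ X]card_ord -prod_nat_const.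
rewrite -big_enum; apply: leq_prod => k _ /=.
by rewrite -subn1 leq_subLR add1n bcount_has_ends ?size_tuple.
Qed.

Definition good_tuples : {set U} :=
  [set u : U | [exists F : {set L}, [exists d in slot_families r F, u \in slot_class d]]]%SET.

(** A tuple of words determines its initial segments, and the first letters of
these determine [F]; hence nothing is counted twice. *)
Lemma card_good_tuples : 2 * r.+1 <= p ->
  (\sum_(F : {set L}) #|slot_families r F|) * (q ^ (p - 2 * r.+1)).-1 ^ n <= #|good_tuples|.
Proof.
move=> rp; pose w0 : W := [tuple of nseq r.+1 (ord0, true)].
pose data (u : U) : {ffun L -> W} :=
  [ffun x => insubd w0 (take r.+1 (slot_word u x))].
pose heads (d : {ffun L -> W}) := [set x | ohead (d x) == Some (linv x)]%SET.
pose A (Fd : {set L} * {ffun L -> W}) :=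
  if Fd.2 \in slot_families r Fd.1 then slot_class Fd.2 else finset.set0.
apply: leq_trans (sum_card_disjoint (A := A)
  (h := fun u => (heads (data u), data u)) _); last first.
  case=> F d u; rewrite /A /=; case: ifP => [dF ud|_]; last by rewrite finset.in_set0.
  have -> : data u = d.
    by apply/ffunP => x; rewrite ffunE (slot_classP ud) valKd.
  have -> : heads d = F.
    apply/setP => x; rewrite inE; have [ws] := slot_families_ok x dF.
    exact: slot_ok_head.
  split=> //; rewrite inE; apply/existsP; exists F; apply/existsP; exists d.
  by rewrite dF.
rewrite big_distrl -(pair_bigA _ (fun F d => #|A (F, d)|)) /=.
apply: leq_sum => F _; rewrite -sum_nat_const big_mkcond /=.
by apply: leq_sum => d _; rewrite /A /=; case: ifP => // dF; apply: card_slot_class dF.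
Qed.

End GoodTuples.

(** * From initial segments to membership in the set of endomorphisms *)

Section Membership.
Variable n : nat.
Local Notation L := ('I_n * bool)%type.
Local Notation G := (free_group n).
Local Open Scope group_scope.
Implicit Types (x y : L) (s t : seq L) (k : 'I_n) (u : {ffun 'I_n -> G}).

Lemma extend_letterV (f : 'I_n -> G) k :
  extend f (letter (k, false)) = (extend f (gen k))^-1.
Proof. by rewrite extend_gen /extend /word_val big_seq1. Qed.

Lemma word_extend_letter u x : word (extend u (letter x)) =
  if x.2 then word (u x.1) else winv (word (u x.1)).
Proof.
case: x => k [] /=; first by rewrite -[letter _]/(gen k) extend_gen.
by rewrite extend_letterV extend_gen wordV.
Qed.

(** Two disjoint occurrences, one read from each end, cut the word in five. *)
Lemma split_both_ends (w : G) s t (a b : L) s' t' :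
    word w = s ++ a :: s' -> winv (word w) = t ++ b :: t' ->
    (size s + size t + 2 <= wlen w)%N ->
  exists c : G, word w = s ++ a :: word c ++ linv b :: winv t.
Proof.
move=> ws wt sz; have rw : reduced (word w) := valP w.
have ws2 : word w = winv t' ++ linv b :: winv t.
  by rewrite -[LHS]winvK wt winv_cat /winv /= rev_cons cat_rcons.
have st' : (size s < size t')%N.
  by move: sz; rewrite /wlen -(size_winv (word w)) wt size_cat /=; lia.
have [c cE] : exists c, winv t' = s ++ a :: c.
  exists (drop (size s).+1 (winv t')).
  have := ws; rewrite ws2 => /(congr1 (take (size s).+1)).
  rewrite takel_cat ?size_winv // -cat_rcons take_size_cat ?size_rcons // => E.
  by rewrite -cat_rcons -E cat_take_drop.
have rc : reduced c.
  by move: rw; rewrite ws2 cE => /reduced_catl/reduced_catr/reduced_behead.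
by exists (FreeGroup rc); rewrite ws2 cE /= -catA.
Qed.

(** [tail x] is $s_k$ for [x = (k, true)] and $l_k$ for [x = (k, false)], and [ys]
is the ordering of the slots. The four types of $\phi(a_k)$ are the four
combinations of fixed and free for the two slots of [k]. The last hypothesis
also shows that the words in the slots are distinct, so that a word of the
ordering cannot be taken for the word of another slot. *)
Lemma Lset_of_tails u (fixed : pred L) (tail : L -> seq L) (ys : seq L) x0 :
    let v x := word (extend u (letter x)) in
    (forall x, exists b t, [/\
       v x = (if fixed x then [::] else tail x) ++ (x.1, b) :: t,
       fixed x -> b = ~~ x.2 &
       (2 * size (if fixed x then [::] else tail x) + 2 <= size (v x))%N]) ->
    (forall x, if fixed x then tail x = [:: linv x]
       else tail x != [::] /\ ~~ has (fun a => a.1 == x.1) (tail x)) ->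
    uniq ys -> (forall x, x \in ys) ->
    (forall i j, (j < i < size ys)%N ->
       ~~ prefix (tail (nth x0 ys i)) (v (nth x0 ys j))) ->
  @Lset n (extend u).
Proof.
move=> v cut tl uys mys ord.
have vV k : v (k, false) = winv (v (k, true)) by rewrite /v !word_extend_letter.
have vgen k : v (k, true) = word (extend u (gen k)) by [].
have rv x : reduced (v x) := valP (extend u (letter x)).
have tail_pre x : prefix (tail x) (v x).
  have [b [t [vE + _]]] := cut x; have := tl x; rewrite {}vE.
  case: (fixed x) => [-> -> // |_ _]; last exact: prefix_prefix.
  by rewrite -cat1s prefix_prefix.
have rt x : reduced (tail x).
  by have := rv x; case/prefixP: (tail_pre x) => t -> /reduced_catl.
have vhead x : ohead (v x) <> Some x.
  have [b [t [vE + _]]] := cut x; have := tl x; rewrite {}vE.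
  case: (fixed x) => [_ -> // [xE]|[]]; first by have := linv_neq x; rewrite -{2}xE eqxx.
  by case: (tail x) => //= y s _ + _ [yx]; rewrite yx eqxx.
pose w x := extend u (letter x).
have winj : injective w.
  suff H x y : (index y ys < index x ys)%N -> w x <> w y.
    move=> x y xy; case: (ltngtP (index y ys) (index x ys)) => [/H[] //|/H[] //|].
    by move=> e; rewrite -(nth_index x0 (mys x)) -e nth_index.
  move=> yx /(congr1 (@word n)) vxy.
  have := ord (index x ys) (index y ys); rewrite yx index_mem mys !nth_index //.
  by move=> /(_ isT); rewrite /v -/(w y) -vxy; rewrite tail_pre.
have ends k : exists c b b', 
    [/\ v (k, true) = (if fixed (k, true) then [::] else tail (k, true))
      ++ (k, b) :: word c ++
      (k, b') :: winv (if fixed (k, false) then [::] else tail (k, false)),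
      fixed (k, true) -> b = false & fixed (k, false) -> b' = false].
  have [b [s [vE fb sz]]] := cut (k, true); have [b' [s' [vE' fb' sz']]] := cut (k, false).
  have [|c cE] := @split_both_ends (w (k, true)) _ _ _ _ _ _ vE (etrans (esym (vV k)) vE').
    have : size (v (k, false)) = size (v (k, true)) by rewrite vV size_winv.
    by rewrite /wlen -/(v (k, true)); lia.
  by exists c, b, (~~ b'); split=> // [/fb'->].
split.
  move=> i w1 w2 [a [a' [e [aE w12]]]]; rewrite -vgen in aE.
  have aE' : v (i, false) = winv (word a') ++ (i, ~~ e) :: winv (word a).
    by rewrite vV aE winv_cat /winv /= rev_cons cat_rcons.
  case: e aE aE' w12 => /= aE aE' [-> ->]; split.
  - by move=> a1; case: (vhead (i, true)); rewrite aE a1.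
  - move/(congr1 (@word n)); rewrite wordV => a1.
    by case: (vhead (i, false)); rewrite aE' a1.
  - move/eqP; rewrite mulg_eq1 invgK => /eqP a1.
    by have := rv (i, true); rewrite aE a1 /reduced /= eqxx.
  - move/eqP; rewrite mulg_eq1 => /eqP/invg_inj a1.
    have := rv (i, true); rewrite aE a1 => /reduced_catr.
    by rewrite /reduced /= eqxx.
pose T x : G := FreeGroup (rt x).
have T1 x : tail x != [::] -> T x <> 1.
  by move=> + /(congr1 (@word n)) /= t1; rewrite t1.
have Tfree k b : ~~ has (fun a => a.1 == k) (tail (k, b)) -> gen_free k (T (k, b)).
  by move=> /hasPn tk e; apply/negP => /tk; rewrite eqxx.
have Tfix x : tail x = [:: linv x] -> T x = (letter x)^-1.
  by move=> tx; apply: val_inj; rewrite /= tx.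
exists (fun k => T (k, true)), (fun k => T (k, false)); split.
  move=> k; have [c [b [b' [vE ft ff]]]] := ends k; rewrite vgen in vE.
  have := tl (k, true); have := tl (k, false).
  case: (fixed (k, true)) ft vE => [/(_ isT)->|_];
    case: (fixed (k, false)) ff => [/(_ isT)->|_] vE tf tt.
  - apply: Or44; split; [exact: Tfix| | by exists c].
    by rewrite Tfix // letter_inv invgK.
  - case: tf => tf1 tf2; apply: Or42; split; [exact: Tfix|exact: T1|exact: Tfree|].
    by exists c, b'.
  - case: tt => tt1 tt2; apply: Or43; split; [exact: T1|exact: Tfree| |].
      by rewrite Tfix // letter_inv invgK.
    by exists c, b.
  - case: tf => tf1 tf2; case: tt => tt1 tt2; apply: Or41.
    by split; [exact: T1|exact: Tfree|exact: T1|exact: Tfree|exists c, b, b'].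
have sys : size ys == (2 * n)%N.
  rewrite -(card_uniqP uys) (eq_card (B := {: L})); last by move=> x; rewrite mys.
  by rewrite card_prod card_ord card_bool mulnC.
pose vs := map_tuple w (Tuple sys).
have vsE (i : 'I_(2 * n)) : tnth vs i = w (nth x0 ys i).
  by rewrite tnth_map (tnth_nth x0).
exists vs; split.
  rewrite (_ : _ ++ _ = map w ([seq (k, true) | k <- enum 'I_n] ++ [seq (k, false) | k <- enum 'I_n])).
    apply: perm_map; apply: uniq_perm => //.
      rewrite cat_uniq !map_inj_uniq; try by move=> ? ? [].
      rewrite -!enumT enum_uniq andbT /=; apply/hasPn => _ /mapP[k _ ->].
      by apply/mapP => -[].
    move=> [k b]; rewrite mys mem_cat; apply/esym/orP.
    by case: b; [left|right]; apply: map_f; rewrite mem_enum.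
  rewrite map_cat -!map_comp; congr (_ ++ _).
  by apply: eq_map => k /=; rewrite /w extend_letterV.
move=> i j k ji; rewrite !vsE.
have key x : w (nth x0 ys i) = w x ->
    Some (word (T x)) <> initial (wlen (T x)) (w (nth x0 ys j)).
  move=> /winj xE; have := ord i j; rewrite ji (eqP sys) ltn_ord => /(_ isT).
  rewrite xE /initial; case: ifP => // _ + [tE].
  by rewrite prefixE => /negP[]; rewrite [X in _ == X]tE.
split=> [|E]; first exact: key.
by apply: key; rewrite E /w extend_letterV.
Qed.

End Membership.

Section GoodTuplesInLset.
Local Open Scope nat_scope.
Variables (m p r : nat).
Local Notation n := m.+1.
Local Notation L := ('I_n * bool)%type.
Local Notation W := (r.+1.-tuple L).
Local Notation U := {ffun 'I_n -> p.-bseq L}.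

Definition group_tuple (u : U) : {ffun 'I_n -> free_group n} :=
  [ffun k => FreeGroup (reduce_reduced (u k))].

Lemma good_tuple_reduced (u : U) k : u \in good_tuples m p r -> reduced (u k).
Proof.
rewrite inE => /existsP[F /existsP[d /andP[_]]].
by rewrite inE => /forallP/(_ k)/and4P[].
Qed.

(** A tail has at most [r + 1] letters, so whether it is a prefix of a slot can be
read off the segment of length [r + 1]; the bound [2 * r.+1] on the lengths keeps
the two segments of a word disjoint. *)
Lemma good_tuple_Lset (u : U) :
  u \in good_tuples m p r -> @Lset n (extend (group_tuple u)).
Proof.
move=> ugood; move: (ugood).
rewrite inE => /existsP[F /existsP[d /andP[dF ud]]].
have x0 : L := (ord0, true).
pose v x := word (extend (group_tuple u) (letter x)).
have vE x : v x = slot_word u x.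
  rewrite /v word_extend_letter /slot_word ffunE /= reduce_id; first by [].
  exact: good_tuple_reduced ugood.
have vd x : v x = d x ++ drop r.+1 (v x).
  by rewrite -{1}(cat_take_drop r.+1 (v x)) {1}vE (slot_classP ud).
have sv x : 2 * r.+1 < size (v x).
  move: ud; rewrite inE => /forallP/(_ x.1)/and4P[_ + _ _].
  by rewrite vE /slot_word; case: x.2; rewrite ?size_winv.
have okx i a : i < 2 * n -> a = 2 * n - i.+1 ->
    slot_ok F (nth x0 (set_last F) a)
      [seq val (d y) | y <- drop a.+1 (set_last F)] (d (nth x0 (set_last F) a)).
  move=> i2n aE; move: dF; rewrite inE.
  move=> /(@slots_ok_split _ _ _ (fun x => val (d x)) _ (take a (set_last F))).
  by apply; rewrite -drop_nth ?cat_take_drop // size_letters_set_last; lia.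
pose tail x := if x \in F then [:: linv x] else stem x.1 (d x).
have ok x : exists ws, slot_ok F x ws (d x) by apply: slot_families_ok dF.
have vF x : x \in F -> v x = linv x :: behead (v x).
  move=> xF; have [ws] := ok x; rewrite /slot_ok xF => /andP[_].
  by rewrite vd; case: (d x : seq L) => //= y s /eqP[->].
apply: (@Lset_of_tails _ _ (mem F) tail (rev (set_last F)) x0) => [x|x||x|i j /andP[ji]].
- case xF: (mem F x).
    exists (~~ x.2), (behead (v x)); split=> //=; last by have := sv x; rewrite /v; lia.
    by rewrite -/(v x) {1}(vF x xF).
  rewrite /tail -[x \in F]/(mem F x) xF.
  have [ws] := ok x; rewrite /slot_ok -[x \in F]/(mem F x) xF => /and3P[_ /andP[_ fs] _].
  set a := (fun a : L => a.1 == x.1) in fs.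
  have := nth_find x0 (a := a) (s := d x); rewrite has_find => /(_ fs)/eqP ax.
  exists (nth x0 (d x) (find a (d x))).2, (drop (find a (d x)).+1 (d x) ++ drop r.+1 (v x)).
  split=> //.
    have dE : d x = take (find a (d x)) (d x) ++
        nth x0 (d x) (find a (d x)) :: drop (find a (d x)).+1 (d x) :> seq L.
      by rewrite -drop_nth // cat_take_drop.
    by rewrite -/(v x) {1}vd {1}dE -catA /stem -/a -ax -surjective_pairing.
  rewrite -/(v x) /stem -/a (size_takel (ltnW fs)).
  by have := sv x; move: fs; rewrite size_tuple; lia.
- case xF: (mem F x); rewrite /tail -[x \in F]/(mem F x) xF //.
  have [ws] := ok x; rewrite /slot_ok -[x \in F]/(mem F x) xF => /and3P[_ /andP[f0 fs] _].
  rewrite /stem; split.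
    by rewrite -size_eq0 (size_takel (ltnW fs)) -lt0n.
  by rewrite has_take ?has_find // ltnn.
- by rewrite rev_uniq set_last_uniq.
- by rewrite mem_rev mem_set_last.
rewrite size_rev => iN; rewrite !nth_rev ?(ltn_trans ji) //.
have := iN; rewrite size_letters_set_last => i2n; have j2n := ltn_trans ji i2n.
have := okx i _ i2n erefl; have := nth_letters_set_last F x0 j2n.
have := nth_letters_set_last F x0 i2n.
set x := nth x0 _ (_ - i.+1); set y := nth x0 _ (_ - j.+1) => xF yF /=.
rewrite -/(v y) /tail /slot_ok xF; case: ifP => iF.
  move=> _; rewrite vF ?yF ?(ltn_trans ji) //= prefix0s andbT.
  apply/eqP => /(can_inj (@linvK n))/eqP.
  by rewrite nth_uniq ?set_last_uniq ?size_letters_set_last //; lia.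
case/and3P => _ /andP[_ fs] /hasPn/(_ (val (d y))) H.
have {H} : ~~ prefix (stem x.1 (d x)) (d y).
  apply: H; apply/mapP; exists y => //.
  have -> : y = nth x0 (drop (2 * n - i.+1).+1 (set_last F)) (i - j.+1).
    by rewrite nth_drop /y; congr nth; lia.
  by apply: mem_nth; rewrite size_drop size_letters_set_last; lia.
apply: contra; rewrite !prefixE {1}vd takel_cat //.
by rewrite /stem (size_takel (ltnW fs)); move: fs; rewrite !size_tuple => /ltnW.
Qed.

End GoodTuplesInLset.

(** * Cardinalities in the ball *)

Section BallCount.
Local Open Scope classical_set_scope.

Lemma card_fset_set_le (T : choiceType) (U : finType) (A : {set U}) (X : set T)
    (g : U -> T) : finite_set X ->
  (forall x, X x -> exists2 u, u \in A & g u = x) ->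
  (#|` fset_set X| <= #|A|)%N.
Proof.
move=> fX Xg; have : (fset_set X `<=` [fset g u | u in A])%fset.
  apply/fsubsetP => x; rewrite in_fset_set // inE => /Xg[u uA <-].
  by apply/imfsetP; exists u.
move/fsubset_leq_card/leq_trans; apply.
by rewrite (leq_trans (leq_imfset_card _ _ _)) //= -cardE.
Qed.

Lemma card_fset_set_ge (T : choiceType) (U : finType) (A : {set U}) (X : set T)
    (g : U -> T) : finite_set X -> {in A &, injective g} ->
  (forall u, u \in A -> X (g u)) -> (#|A| <= #|` fset_set X|)%N.
Proof.
move=> fX ginj Xg; have : ([fset g u | u in A] `<=` fset_set X)%fset.
  apply/fsubsetP => _ /imfsetP[u /= uA ->].
  by rewrite in_fset_set // inE; apply: Xg.
move/fsubset_leq_card; apply: leq_trans.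
by rewrite card_in_imfset //= -cardE.
Qed.

Variable m : nat.
Local Notation n := m.+1.
Local Notation q := (2 * m).+1.

Lemma card_ball_pow p :
  (m ^ n * #|` fset_set (@ball_pow n p)| <= (n * q ^ p) ^ n)%N.
Proof.
pose A := [set u : {ffun 'I_n -> p.-bseq ('I_n * bool)} |
  [forall k, reduced (u k)]]%SET.
have cA : #|A| = (bcount p (@reduced n) ^ n)%N.
  rewrite -[X in (_ ^ X)%N]card_ord -card_ffun_on; apply: eq_card => u.
  by rewrite inE; apply: eq_forallb => k; rewrite inE.
have le_ball : (#|` fset_set (@ball_pow n p)| <= #|A|)%N.
  apply: (card_fset_set_le (g := @group_tuple m p)); first exact: finite_ball_pow.
  move=> t tp; exists [ffun k => Bseq (tp k)].
    by rewrite inE; apply/forallP => k; rewrite ffunE; apply: valP (t k).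
  apply/ffunP => k; rewrite !ffunE; apply: val_inj => /=.
  by rewrite reduce_id //; apply: valP (t k).
apply: leq_trans (leq_mul (leqnn _) le_ball) _.
by rewrite cA -expnMn leq_exp2r // bcount_reduced.
Qed.

Lemma card_Lset_ball p r :
  (#|good_tuples m p r| <=
   #|` fset_set ((@tuple_of_endo n @` @Lset n) `&` @ball_pow n p)|)%N.
Proof.
apply: (@card_fset_set_ge _ _ _ _ (@group_tuple m p)).
- by apply: (@sub_finite_set _ _ (@ball_pow n p)) => [x []|]; last exact: finite_ball_pow.
- move=> u u' ug u'g /ffunP uu'; apply/ffunP => k; apply: val_inj.
  have := congr1 (@word n) (uu' k); rewrite !ffunE /=.
  by rewrite !reduce_id // (good_tuple_reduced _ ug, good_tuple_reduced _ u'g).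
- move=> u ug; split.
    exists (extend (group_tuple u)); first exact: good_tuple_Lset ug.
    by apply/ffunP => k; rewrite [LHS]ffunE; apply: extend_gen.
  move=> k; rewrite ffunE /wlen /= reduce_id ?(good_tuple_reduced _ ug) //.
  exact: size_bseq.
Qed.

End BallCount.

(** * The bound as a sum over sets of slots *)

Section Sums.
Variable R : comNzRingType.
Implicit Types (g : nat -> R) (p : {poly R}).

Lemma sum_over_sets (T : finType) g :
  \sum_(F : {set T}) g #|F| = \sum_(f < #|T|.+1) 'C(#|T|, f)%:R * g f.
Proof.
pose h (F : {set T}) : 'I_#|T|.+1 := Ordinal (max_card F : (#|F| < #|T|.+1)%N).
rewrite (partition_big h predT) //=; apply: eq_bigr => f _.
rewrite (eq_bigr (fun=> g f)) => [|F /eqP<- //].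
rewrite sumr_const -card_draws mulr_natl; congr (_ *+ _).
by apply: eq_card => F; rewrite !inE.
Qed.

(** Both sides evaluate the linear functional sending $X^i$ to [g i] on
$(1 + X)^{2n} = (X^2 + 2X + 1)^n$. *)
Lemma sum_trinomial N g :
  \sum_(f < (2 * N).+1) 'C(2 * N, f)%:R * g f =
  \sum_(c < N.+1) \sum_(b < (N - c).+1)
    'C(N, c)%:R * 'C(N - c, b)%:R * 2 ^+ b * g (2 * c + b)%N.
Proof.
pose ev p : R := \sum_(i < (2 * N).+1) p`_i * g i.
have evD I (r : seq I) P (F : I -> {poly R}) :
    ev (\sum_(i <- r | P i) F i) = \sum_(i <- r | P i) ev (F i).
  rewrite /ev exchange_big /=; apply: eq_bigr => i _.
  by rewrite coef_sum mulr_suml.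
have evX a i : (i <= 2 * N)%N -> ev (a *: 'X^i) = a * g i.
  move=> iN; pose i' : 'I_(2 * N).+1 := Ordinal (iN : (i < (2 * N).+1)%N).
  rewrite /ev (bigD1 i') //=.
  rewrite coefZ coefXn eqxx mulr1 big1 ?addr0 // => j ji.
  by rewrite coefZ coefXn -[_ == i]/(j == i') (negPf ji) mulr0 mul0r.
transitivity (ev ((1 + 'X) ^+ (2 * N))).
  rewrite exprDn evD; apply: eq_bigr => f _.
  by rewrite expr1n mul1r -[X in ev X]scaler_nat evX // -ltnS.
have -> : (1 + 'X) ^+ (2 * N) = ((1 + 2 *: 'X) + 'X^2) ^+ N :> {poly R}.
  by rewrite exprM; congr (_ ^+ _); rewrite -mul_polyC; ring.
rewrite exprDn evD; apply: eq_bigr => c _.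
have cN : (c <= N)%N by rewrite -ltnS.
rewrite exprDn mulr_suml -sumrMnl evD; apply: eq_bigr => b _.
have bN : (b <= N - c)%N by rewrite -ltnS.
rewrite expr1n mul1r exprZn -exprM mulrnAl -scalerAl -exprD -mulrnA -[X in ev X]scaler_nat.
by rewrite scalerA evX ?natrM; [rewrite addnC; ring | lia].
Qed.

Lemma prod_pairs (f : nat -> R) a e :
  \prod_(2 * a <= i < 2 * e) f i =
  \prod_(a <= k < e) (f (2 * k)%N * f (2 * k).+1).
Proof.
have [ae|ea] := leqP a e; last by rewrite !big_geq //; lia.
rewrite -(subnKC ae); elim: (e - a)%N => [|d IH]; first by rewrite addn0 !big_geq.
rewrite addnS mulnS add2n !big_nat_recr //=; try lia.
by rewrite IH mulrA.
Qed.

End Sums.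

Section BoundAsSum.
Variables (R : realType) (m : nat).
Local Notation n := m.+1.
Local Notation q := (2 * m).+1.

(** In each word of length at most $p$ two segments of length [r + 1] are prescribed,
which leaves a proportion of at least $(m/n) q^{-2(r+1)}$ of the words,
asymptotically; the weights of its two slots are in units of [q ^ r], whence
$(m/n) q^{-2}$ for each generator. *)
Definition slot_density : R := (m%:R / n%:R) / q%:R ^+ 2.

(** With [f = 2 * c + b], the first [b] factors of the product go to the free slots
of the Type 1 words and the others, in pairs, to the Type 0 words; each of the [n]
words takes one factor [slot_density]. *)
Lemma dstarE : (0 < m)%N -> dstar R n = slot_density ^+ n *
  \sum_(f < (2 * n).+1) 'C(2 * n, f)%:R * \prod_(f <= i < 2 * n) slot_weight m R i.
Proof.
move=> m0.
have densE : slot_density = m%:R / n%:R / q%:R ^+ 2 by [].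
have hm : n%:R - 1 = m%:R :> R by rewrite -natr1 addrK.
have hq : 2 * n%:R - 1 = q%:R :> R by rewrite -[in RHS]natr1 natrM -natr1; ring.
have n0 : n%:R != 0 :> R by rewrite pnatr_eq0.
have m0' : m%:R != 0 :> R by rewrite pnatr_eq0 -lt0n.
have q0 : q%:R != 0 :> R by rewrite pnatr_eq0.
(* Opaque names keep [field] from expanding the two casts. *)
have [Q QE] : exists Q : R, Q = q%:R by exists q%:R.
have [N NE] : exists N : R, N = n%:R by exists n%:R.
rewrite -QE -?NE in hm hq q0 n0 densE.
rewrite (sum_trinomial n (fun f => \prod_(f <= i < 2 * n) slot_weight m R i)).
rewrite /dstar big_mkord mulr_sumr; apply: eq_bigr => c _.
rewrite big_mkord mulr_sumr; apply: eq_bigr => b _.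
have cn : (c <= n)%N by rewrite -ltnS.
have bn : (b <= n - c)%N by rewrite -ltnS.
rewrite [RHS]mulrCA -!mulrA; do 3 congr (_ * _).
rewrite [X in _ = _ * X](@big_cat_nat _ _ _ (2 * (c + b))) /=; try lia.
rewrite prod_pairs.
have -> : slot_density ^+ n =
    slot_density ^+ c * (slot_density ^+ b * slot_density ^+ (n - (c + b))).
  by rewrite -!exprD; congr (_ ^+ _); lia.
rewrite -NE hm hq -!mulrA; congr (_ * _).
  by congr (_ ^+ _); rewrite densE; field; rewrite q0 n0.
rewrite mulrC [RHS]mulrA [RHS]mulrACA; congr (_ * _).
  have -> : slot_density ^+ b = \prod_(1 <= j < b.+1) slot_density.
    by rewrite prodr_const_nat subn1.
  rewrite -[(2 * c + b)%N]add0n.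
  have -> : (2 * (c + b) = b + (2 * c + b))%N by lia.
  rewrite big_addn addnK !big_add1 -big_split /=; apply: eq_bigr => j _.
  have jcb : (j + (2 * c + b))%:R = j%:R + (2 * c%:R + b%:R) :> R.
    by rewrite 2!natrD natrM.
  rewrite densE /slot_weight jcb -natr1; field.
  by rewrite m0' n0 q0.
rewrite -prodr_const_nat /Kcoef big_add1 /= -big_split; apply: eq_bigr => k _ /=.
rewrite -NE hm hq densE /slot_weight -!natr1 natrM; field.
by rewrite m0' n0 q0.
Qed.

Lemma dstar_sets : (0 < m)%N -> dstar R n = slot_density ^+ n *
  \sum_(F : {set 'I_n * bool}) \prod_(#|F| <= i < 2 * n) slot_weight m R i.
Proof.
move=> m0; rewrite dstarE //; congr (_ * _).
rewrite (sum_over_sets _ (fun f => \prod_(f <= i < 2 * n) slot_weight m R i)).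
by have -> : #|{: 'I_n * bool}| = (2 * n)%N by rewrite card_letter; lia.
Qed.

End BoundAsSum.

(** For [m = 1] the weights are [2 - i], so only the sets with at least three slots
contribute: four times [-1], and once [1]. *)
Lemma dstar2_le0 (R : realType) : dstar R 2 <= 0.
Proof.
rewrite dstarE // mulr_ge0_le0 ?exprn_ge0 //.
  by rewrite /slot_density !divr_ge0 ?exprn_ge0 ?ler0n.
rewrite !big_ord_recr big_ord0 /= !unlock /= /slot_weight.
rewrite !bin1 !bin0 !binn -['C(2 * 2, 2)]/6%N -['C(2 * 2, 3)]/4%N; lra.
Qed.

(** * Passing to the limit *)

Section Limit.
Variables (R : realType) (m : nat).
Local Notation n := m.+1.
Local Notation q := (2 * m).+1.
Local Notation qR := (q%:R : R).
Local Notation dens := (density_seq R (@tuple_of_endo n @` @Lset n)).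

(** The last factor accounts for the words too short for two disjoint segments. *)
Lemma density_seq_ge p r : (2 <= m)%N -> slot_error m R r <= 1 ->
    (2 * r.+1 <= p)%N ->
  dstar R n * (1 - slot_error m R r) ^+ (2 * n) *
    (1 - qR ^+ (2 * r.+1) * qR^-1 ^+ p) ^+ n <= dens p.
Proof.
move=> m2 e1 rp; have m0 : (0 < m)%N by apply: ltn_trans m2.
set e := slot_error m R r in e1 *.
pose S : R := \sum_(F : {set 'I_n * bool}) \prod_(#|F| <= i < 2 * n) slot_weight m R i.
pose X : R := qR ^+ r * (1 - e).
pose Y : nat := (q ^ (p - 2 * r.+1)).-1.
have X0 : 0 <= X by rewrite mulr_ge0 ?exprn_ge0 ?subr_ge0.
have goodS : X ^+ (2 * n) * S * Y%:R ^+ n <= #|good_tuples m p r|%:R.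
  apply: le_trans (_ : (\sum_(F : {set 'I_n * bool}) #|slot_families r F|)%:R
    * Y%:R ^+ n <= _); last first.
    by rewrite -natrX -natrM ler_nat card_good_tuples.
  rewrite ler_wpM2r ?exprn_ge0 // /S mulr_sumr natr_sum.
  by apply: ler_sum => F _; apply: card_slot_families.
rewrite /density_seq.
have := card_Lset_ball m p r; have := card_ball_pow m p.
set A := #|` fset_set (_ `&` _)|; set B := #|` fset_set (@ball_pow n p)|.
move=> hB; rewrite -(ler_nat R) => hA.
have B0 : (0 < B)%N.
  have <- : #|[set: unit]%SET| = 1%N by rewrite cardsT card_unit.
  apply: (card_fset_set_ge (g := fun=> [ffun=> fg_one n])) => [|[] []|u _ k] //.
    exact: finite_ball_pow.
  by rewrite ffunE.
have {}hB : m%:R ^+ n * B%:R <= (n%:R * qR ^+ p) ^+ n.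
  by rewrite -!natrX -!natrM -natrX ler_nat.
rewrite ler_pdivlMr ?ltr0n //; apply: le_trans hA; apply: le_trans goodS.
have q0 : qR != 0 by rewrite pnatr_eq0.
have n0 : n%:R != 0 :> R by rewrite pnatr_eq0.
have YE : Y%:R = qR ^+ p * qR^-1 ^+ (2 * r.+1) - 1 :> R.
  rewrite /Y -subn1 natrB ?expn_gt0 // natrX -{2}(subnK rp) exprD exprVn.
  by rewrite mulfK // expf_neq0.
have ZE : 1 - qR ^+ (2 * r.+1) * qR^-1 ^+ p =
    qR ^+ (2 * r.+1) * qR^-1 ^+ p * Y%:R :> R.
  rewrite YE mulrBr mulr1 !exprVn; congr (_ - _); field.
  by rewrite !expf_neq0.
rewrite dstar_sets // -/S ZE.
have S0 : 0 <= S.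
  apply: sumr_ge0 => F _; rewrite big_nat; apply: prodr_ge0 => i /andP[_ i2n].
  by rewrite ltW ?slot_weight_gt0.
have T0 : 0 <= X ^+ (2 * n) * S * Y%:R ^+ n by rewrite !mulr_ge0 ?exprn_ge0.
have ratio1 : m%:R ^+ n * B%:R / (n%:R * qR ^+ p) ^+ n <= 1.
  by rewrite ler_pdivrMr ?mul1r // exprn_gt0 // mulr_gt0 ?exprn_gt0 ?ltr0n.
apply: le_trans (ler_piMr T0 ratio1); rewrite le_eqVlt; apply/orP; left; apply/eqP.
have kE : slot_density R m * (qR ^+ (2 * r.+1) * qR^-1 ^+ p) =
    (qR ^+ r) ^+ 2 * (m%:R / (n%:R * qR ^+ p)).
  have -> : (2 * r.+1 = r * 2 + 2)%N by lia.
  have b0 : qR ^+ p != 0 by rewrite expf_neq0.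
  rewrite /slot_density exprVn exprD exprM.
  move: (qR) (n%:R) (qR ^+ p) q0 n0 b0 => Q N b q0 n0 b0; field.
  by rewrite q0 n0 b0.
have group_powers k s t w y b :
    k ^+ n * s * t * (w * y) ^+ n * b = (k * w) ^+ n * (s * t * y ^+ n * b) :> R.
  by rewrite !exprMn; ring.
rewrite group_powers kE /X; move: (qR ^+ r) (1 - e) (n%:R * _) => a d b.
rewrite !exprMn exprVn mul2n -addnn !exprD.
move: (a ^+ n) (d ^+ n) (m%:R ^+ n : R) (b ^+ n) (Y%:R ^+ n : R) (B%:R : R).
by move=> an dn mn bn yn B'; ring.
Qed.

Lemma dstar_le_lim : (2 <= m)%N -> cvgn dens -> dstar R n <= limn dens.
Proof.
move=> m2 hD.
have q1 : qR^-1 < 1 by rewrite invf_lt1 ?ltr1n ?ltr0n //; lia.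
have cvg_power (c a z : R) (k : nat) : `|z| < 1 ->
    c * (1 - a * z ^+ i) ^+ k @[i --> \oo] --> c.
  move=> z1; have base : (1 - a * z ^+ i) @[i --> \oo] --> 1 - a * 0.
    apply: cvgB; first exact: cvg_cst.
    by apply: cvgM; [exact: cvg_cst | exact: cvg_expr].
  rewrite mulr0 subr0 in base.
  have power : (1 - a * z ^+ i) ^+ k @[i --> \oo] --> (1 : R) ^+ k.
    exact: (cvg_comp _ _ base (@exprn_continuous R k 1)).
  have scaled : c * (1 - a * z ^+ i) ^+ k @[i --> \oo] --> c * 1 ^+ k.
    by apply: cvgM; [exact: cvg_cst | exact: power].
  by rewrite expr1n mulr1 in scaled.
have lim_ge r : slot_error m R r <= 1 ->
    dstar R n * (1 - slot_error m R r) ^+ (2 * n) <= limn dens.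
  move=> e1; set c := dstar R n * _.
  have cc := cvg_power c (qR ^+ (2 * r.+1)) qR^-1 n.
  rewrite -(cvg_lim _ (cc _)) //; last by rewrite ger0_norm ?invr_ge0.
  apply: ler_lim => //; first by apply: cvgP (cc _); rewrite ger0_norm ?invr_ge0.
  exists (2 * r.+1)%N => // p /= rp; exact: density_seq_ge.
set z : R := (2 * m).-1%:R / qR.
have z1 : `|z| < 1.
  by rewrite ger0_norm ?divr_ge0 // ltr_pdivrMr ?ltr0n // mul1r ltr_nat; lia.
have cz := cvg_power (dstar R n) (2 * m%:R ^+ 2) z (2 * n)%N z1.
rewrite -(cvg_lim _ cz) //; apply: limr_le; first exact: cvgP cz.
have err0 : slot_error m R r @[r --> \oo] --> (2 * m%:R ^+ 2 : R) * 0.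
  by apply: cvgM; [exact: cvg_cst | exact: cvg_expr].
rewrite mulr0 in err0; near=> r; apply/lim_ge/ltW; near: r.
exact: (cvgr_lt 0 err0 1 ltr01).
Unshelve. all: by end_near. Qed.

End Limit.

Unset Implicit Arguments.
Unset Printing Implicit Defensive.

Theorem theorem21 (R : realType) (n : nat) (hn : (2 <= n)%N)
    (hD : cvgn (density_seq R (@tuple_of_endo n @` @Lset n))) :
  dstar R n <= limn (density_seq R (@tuple_of_endo n @` @Lset n)).
Proof.
case: n => [|[|[|m]]] // in hn hD *; last exact: dstar_le_lim.
apply: le_trans (dstar2_le0 R) _; apply: limr_ge => //.
by apply: nearW => p; rewrite /density_seq divr_ge0.
Qed.
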